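(* Let $\mathbf{T}$ be an equationally defined (multi-sorted) algebraic theory with set of sorts $S$, with associated small category with finite products $\mathcal{T}$ and product-preserving, identity-on-objects functor $T: S^*\to\mathcal{T}$. Let $\mathcal{A}$ be an abelian category, let $\mathcal{M}=\mathrm{FPFunct}(\mathcal{T},\mathcal{A})$, and let $I$ be a discrete subcategory of $S^*$. Suppose $S\subset I$. Then the functor $\Box_I:\mathcal{M}\to\mathcal{A}^I$ is faithful.
   Context: $S^*$ is the set of finite words in the alphabet $S$ (including the empty word), regarded as a category with finite products in the obvious way: finite products are given by concatenation, the empty word is terminal, and a morphism $s_1\cdots s_n\to t_1\cdots t_m$ is a function $\alpha:\{1,\dots,m\}\to\{1,\dots,n\}$ with $s_{\alpha(j)}=t_j$ for all $j$. The set $S$ is regarded as the set of one-letter words in $S^*$. An algebraic theory $\mathbf{T}$ of signature $S$ is represented by a small category $\mathcal{T}$ with finite products together with a product-preserving functor $T:S^*\to\mathcal{T}$ that is the identity on objects; the category of models of $\mathbf{T}$ in a category $\mathcal{A}$ with finite products is equivalent to $\mathrm{FPFunct}(\mathcal{T},\mathcal{A})$, the full subcategory of $\mathrm{Funct}(\mathcal{T},\mathcal{A})$ consisting of the functors that preserve finite products (including the terminal object). A discrete subcategory $I$ of $S^*$ is a set of words with only identity morphisms. $\mathcal{A}^I=\mathrm{Funct}(I,\mathcal{A})$ is the category of $I$-indexed families of objects of $\mathcal{A}$, with pointwise abelian structure. The functor $\Box_I:\mathcal{M}\to\mathcal{A}^I$ sends $F$ to its composition with $U_I: I\hookrightarrow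 S^*\xrightarrow{T}\mathcal{T}$, i.e. to the family $(F(i))_{i\in I}$, and a natural transformation $\varphi$ to the family of its components $(\varphi_i)_{i\in I}$. *)

(* Defs.v *)
From mathcomp Require Import all_boot.
From mathcomp Require Import boolp classical_sets.

Set Implicit Arguments.
Unset Strict Implicit.
Unset Printing Implicit Defensive.

Structure category := Category {
  ob :> Type;
  hom : ob -> ob -> Type;
  idm : forall a, hom a a;
  comp : forall a b c, hom b c -> hom a b -> hom a c;
  comp1m : forall a b (f : hom a b), comp (idm b) f = f;
  compm1 : forall a b (f : hom a b), comp f (idm a) = f;
  compA : forall a b c d (h : hom c d) (g : hom b c) (f : hom a b),
    comp h (comp g f) = comp (comp h g) f
}.

Arguments hom {c} a b : rename.
Arguments idm {c} a : rename.
Arguments comp {c a b c0} g f : rename.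

Notation "g \oc f" := (comp g f) (at level 50, left associativity).

Structure functor (C D : category) := Functor {
  fob :> C -> D;
  fmap : forall a b, hom a b -> hom (fob a) (fob b);
  fmap1 : forall a, fmap (idm a) = idm (fob a);
  fmapM : forall a b c (g : hom b c) (f : hom a b),
    fmap (g \oc f) = fmap g \oc fmap f
}.

Arguments fmap {C D} F {a b} f : rename.

Structure nattrans (C D : category) (F G : functor C D) := NatTrans {
  component :> forall a, hom (F a) (G a);
  natural : forall a b (f : hom a b),
    component b \oc fmap F f = fmap G f \oc component a
}.

Lemma nattrans_ext (C D : category) (F G : functor C D)
  (u v : nattrans F G) : (forall a, u a = v a) -> u = v.
Proof.
case: u v => [u nu] [v nv] /= uv.
by case: _ / (functional_extensionality_dep uv) nv => nv; rewrite (Prop_irrelevance nu nv).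
Qed.

Definition faithful (C D : category) (F : functor C D) :=
  forall a b, injective (@fmap C D F a b).

Section FunctorComposition.
Variables (C D E : category) (G : functor D E) (F : functor C D).

Lemma fcomp1 a : fmap G (fmap F (idm a)) = idm (G (F a)).
Proof. by rewrite !fmap1. Qed.

Lemma fcompM a b c (g : hom b c) (f : hom a b) :
  fmap G (fmap F (g \oc f)) = fmap G (fmap F g) \oc fmap G (fmap F f).
Proof. by rewrite !fmapM. Qed.

Definition fcomp : functor C E := Functor fcomp1 fcompM.
End FunctorComposition.

Section FunctorCategory.
Variables C D : category.

Lemma nat_id_natural (F : functor C D) a b (f : hom a b) :
  idm (F b) \oc fmap F f = fmap F f \oc idm (F a).
Proof. by rewrite comp1m compm1. Qed.

Definition nat_id (F : functor C D) : nattrans F F :=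
  NatTrans (@nat_id_natural F).

Lemma nat_comp_natural (F G H : functor C D) (v : nattrans G H)
    (u : nattrans F G) a b (f : hom a b) :
  (v b \oc u b) \oc fmap F f = fmap H f \oc (v a \oc u a).
Proof. by rewrite -compA natural compA natural compA. Qed.

Definition nat_comp (F G H : functor C D) (v : nattrans G H)
  (u : nattrans F G) : nattrans F H := NatTrans (nat_comp_natural v u).

Lemma nat_comp1m (F G : functor C D) (u : nattrans F G) :
  nat_comp (nat_id G) u = u.
Proof. by apply: nattrans_ext => a /=; rewrite comp1m. Qed.

Lemma nat_compm1 (F G : functor C D) (u : nattrans F G) :
  nat_comp u (nat_id F) = u.
Proof. by apply: nattrans_ext => a /=; rewrite compm1. Qed.

Lemma nat_compA (F G H K : functor C D) (w : nattrans H K)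
    (v : nattrans G H) (u : nattrans F G) :
  nat_comp w (nat_comp v u) = nat_comp (nat_comp w v) u.
Proof. by apply: nattrans_ext => a /=; rewrite compA. Qed.

Definition Funct : category := Category nat_comp1m nat_compm1 nat_compA.
End FunctorCategory.

Section Precomposition.
Variables (C D E : category) (U : functor C D).

Lemma whisker_natural (F G : functor D E) (u : nattrans F G)
    a b (f : hom a b) :
  u (U b) \oc fmap F (fmap U f) = fmap G (fmap U f) \oc u (U a).
Proof. exact: natural. Qed.

Definition whisker (F G : functor D E) (u : nattrans F G) :
  nattrans (fcomp F U) (fcomp G U) :=
  @NatTrans _ _ (fcomp F U) (fcomp G U) (fun a => u (U a))
            (whisker_natural u).

Lemma whisker1 (F : functor D E) : whisker (nat_id F) = nat_id (fcomp F U).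
Proof. exact: nattrans_ext. Qed.

Lemma whiskerM (F G H : functor D E) (v : nattrans G H) (u : nattrans F G) :
  whisker (nat_comp v u) = nat_comp (whisker v) (whisker u).
Proof. exact: nattrans_ext. Qed.

Definition precomp : functor (Funct D E) (Funct C E) :=
  @Functor (Funct D E) (Funct C E) (fun F => fcomp F U) whisker
           whisker1 whiskerM.
End Precomposition.

Section FullSubcategory.
Variables (C : category) (P : C -> Prop).

Definition full_subcat : category :=
  @Category {a : C | P a} (fun a b => hom (sval a) (sval b))
    (fun a => idm (sval a)) (fun a b c g f => g \oc f)
    (fun a b => @comp1m C (sval a) (sval b))
    (fun a b => @compm1 C (sval a) (sval b))
    (fun a b c d => @compA C (sval a) (sval b) (sval c) (sval d)).

Definition full_incl : functor full_subcat C :=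
  @Functor full_subcat C (fun a => sval a) (fun a b f => f)
           (fun=> erefl) (fun _ _ _ _ _ => erefl).
End FullSubcategory.

Definition is_product (C : category) (J : Type) (X : J -> C) (P : C)
    (p : forall j, hom P (X j)) : Prop :=
  forall (Z : C) (f : forall j, hom Z (X j)),
    exists! h : hom Z P, forall j, p j \oc h = f j.

(* The case n = 0 is a terminal object. *)
Definition has_finite_products (C : category) : Prop :=
  forall (n : nat) (X : 'I_n -> C),
    exists (P : C) (p : forall j, hom P (X j)), is_product p.

Definition preserves_finite_products (C D : category) (F : functor C D) :
    Prop :=
  forall (n : nat) (X : 'I_n -> C) (P : C) (p : forall j, hom P (X j)),
    is_product p ->
    @is_product D 'I_n (fun j => F (X j)) (F P) (fun j => fmap F (p j)).

Definition FPFunct (C D : category) : category :=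
  @full_subcat (Funct C D) (@preserves_finite_products C D).

Record preadditive (C : category) := Preadditive {
  zerom : forall a b : C, hom a b;
  oppm : forall a b : C, hom a b -> hom a b;
  addm : forall a b : C, hom a b -> hom a b -> hom a b;
  addmA : forall (a b : C) (f g h : hom a b),
    addm f (addm g h) = addm (addm f g) h;
  addmC : forall (a b : C) (f g : hom a b), addm f g = addm g f;
  add0m : forall (a b : C) (f : hom a b), addm (zerom a b) f = f;
  addNm : forall (a b : C) (f : hom a b), addm (oppm f) f = zerom a b;
  compDl : forall (a b c : C) (g1 g2 : hom b c) (f : hom a b),
    addm g1 g2 \oc f = addm (g1 \oc f) (g2 \oc f);
  compDr : forall (a b c : C) (g : hom b c) (f1 f2 : hom a b),
    g \oc addm f1 f2 = addm (g \oc f1) (g \oc f2)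
}.

Definition mono (C : category) (a b : C) (f : hom a b) : Prop :=
  forall (z : C) (u v : hom z a), f \oc u = f \oc v -> u = v.

Definition epi (C : category) (a b : C) (f : hom a b) : Prop :=
  forall (z : C) (u v : hom b z), u \oc f = v \oc f -> u = v.

Definition is_zero_object (C : category) (z : C) : Prop :=
  forall a : C,
    (exists! f : hom a z, True) /\ (exists! f : hom z a, True).

Section Preadditive.
Variables (C : category) (A : preadditive C).

Definition is_biproduct (a b s : C) (p1 : hom s a) (p2 : hom s b)
    (i1 : hom a s) (i2 : hom b s) : Prop :=
  [/\ p1 \oc i1 = idm a, p2 \oc i2 = idm b
    & addm A (i1 \oc p1) (i2 \oc p2) = idm s].

Definition is_kernel (a b k : C) (f : hom a b) (i : hom k a) : Prop :=
  f \oc i = zerom A k b /\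
  forall (z : C) (u : hom z a), f \oc u = zerom A z b ->
    exists! v : hom z k, i \oc v = u.

Definition is_cokernel (a b q : C) (f : hom a b) (p : hom b q) : Prop :=
  p \oc f = zerom A a q /\
  forall (z : C) (u : hom b z), u \oc f = zerom A a z ->
    exists! v : hom q z, v \oc p = u.
End Preadditive.

Structure abelian_category := AbelianCategory {
  ab_cat :> category;
  ab_add : preadditive ab_cat;
  ab_zero : exists z : ab_cat, is_zero_object z;
  ab_biproduct : forall a b : ab_cat,
    exists (s : ab_cat) (p1 : hom s a) (p2 : hom s b)
           (i1 : hom a s) (i2 : hom b s), is_biproduct ab_add p1 p2 i1 i2;
  ab_kernel : forall (a b : ab_cat) (f : hom a b),
    exists (k : ab_cat) (i : hom k a), is_kernel ab_add f i;
  ab_cokernel : forall (a b : ab_cat) (f : hom a b),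
    exists (q : ab_cat) (p : hom b q), is_cokernel ab_add f p;
  ab_mono : forall (k a : ab_cat) (i : hom k a), mono i ->
    exists (b : ab_cat) (f : hom a b), is_kernel ab_add f i;
  ab_epi : forall (b q : ab_cat) (p : hom b q), epi p ->
    exists (a : ab_cat) (f : hom a b), is_cokernel ab_add f p
}.

Section Words.
Variable S : Type.

Notation letter w := (tnth (in_tuple w)).

(* A morphism s -> t goes from the positions of t to those of s, so that the
   empty word is terminal and concatenation is the binary product. *)
Structure word_hom (s t : seq S) := WordHom {
  reindex :> 'I_(size t) -> 'I_(size s);
  reindexP : forall j, letter s (reindex j) = letter t j
}.

Lemma word_hom_ext (s t : seq S) (f g : word_hom s t) :
  (forall j, f j = g j) -> f = g.
Proof.
case: f g => [f hf] [g hg] /= fg.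
by case: _ / (functional_extensionality_dep fg) hg => hg; rewrite (Prop_irrelevance hf hg).
Qed.

Definition word_id (s : seq S) : word_hom s s :=
  @WordHom s s id (fun=> erefl).

Lemma word_comp_letter (s t u : seq S) (g : word_hom t u)
    (f : word_hom s t) j : letter s (f (g j)) = letter u j.
Proof. by rewrite !reindexP. Qed.

Definition word_comp (s t u : seq S) (g : word_hom t u) (f : word_hom s t) :
  word_hom s u := WordHom (word_comp_letter g f).

Lemma word_comp1m (s t : seq S) (f : word_hom s t) :
  word_comp (word_id t) f = f.
Proof. exact: word_hom_ext. Qed.

Lemma word_compm1 (s t : seq S) (f : word_hom s t) :
  word_comp f (word_id s) = f.
Proof. exact: word_hom_ext. Qed.

Lemma word_compA (s t u v : seq S) (h : word_hom u v) (g : word_hom t u)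
    (f : word_hom s t) :
  word_comp h (word_comp g f) = word_comp (word_comp h g) f.
Proof. exact: word_hom_ext. Qed.

Definition words : category := Category word_comp1m word_compm1 word_compA.
End Words.

(* An algebraic theory with set of sorts S is represented by a category with
   finite products whose objects are the words over S, and a product-preserving
   identity-on-objects functor from S^* to it.  No size condition is imposed:
   smallness is relative to the ambient universe. *)
Structure algebraic_theory (S : Type) := AlgebraicTheory {
  th_hom : seq S -> seq S -> Type;
  th_idm : forall a, th_hom a a;
  th_comp : forall a b c, th_hom b c -> th_hom a b -> th_hom a c;
  th_comp1m : forall a b (f : th_hom a b), th_comp (th_idm b) f = f;
  th_compm1 : forall a b (f : th_hom a b), th_comp f (th_idm a) = f;
  th_compA : forall a b c d (h : th_hom c d) (g : th_hom b c)
    (f : th_hom a b), th_comp h (th_comp g f) = th_comp (th_comp h g) f;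
  th_cat :> category := Category th_comp1m th_compm1 th_compA;
  th_products : has_finite_products th_cat;
  th_functor : functor (words S) th_cat;
  th_functor_ob : forall w : seq S, th_functor w = w :> seq S;
  th_functor_products : preserves_finite_products th_functor
}.

Section Discrete.
Variables (S : Type) (I : set (seq S)).

Definition disc : category :=
  @Category {w : seq S | I w} (fun i j => i = j) (fun=> erefl)
    (fun i j k g f => etrans f g)
    (fun _ _ _ => Prop_irrelevance _ _) (fun _ _ _ => Prop_irrelevance _ _)
    (fun _ _ _ _ _ _ _ => Prop_irrelevance _ _).

Definition disc_incl_map (i j : disc) (e : hom i j) :
    @hom (words S) (sval i) (sval j) :=
  match e in _ = j return @hom (words S) (sval i) (sval j) with
  | erefl => @idm (words S) (sval i)
  end.

Lemma disc_incl_mapM (i j k : disc) (g : hom j k) (f : hom i j) :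
  disc_incl_map (g \oc f) = disc_incl_map g \oc disc_incl_map f.
Proof. by case: _ / g; case: _ / f; rewrite [RHS]comp1m. Qed.

Definition disc_incl : functor disc (words S) :=
  @Functor disc (words S) (fun i => sval i) disc_incl_map
           (fun=> erefl) disc_incl_mapM.
End Discrete.

Section Box.
Variables (S : Type) (T : algebraic_theory S) (A : category) (I : set (seq S)).

(* The composite I -> S^* -> T, whose source is the discrete category on I. *)
Definition U_ : functor (disc I) T := fcomp (th_functor T) (disc_incl I).

Definition Box : functor (FPFunct T A) (Funct (disc I) A) :=
  fcomp (precomp A U_)
        (@full_incl (Funct T A) (@preserves_finite_products T A)).
End Box.

(* Main.v *)
(** Every word is the product in [S^*], hence in the theory, of its letters.
    A finite-product-preserving functor [G] therefore sends the letter
    projections of a word to a jointly monic family, so by naturality a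
    transformation into [G] is determined by its components at letters. *)
Require Import Defs.
From mathcomp Require Import all_boot.
From mathcomp Require Import boolp classical_sets.
Local Open Scope classical_set_scope.

Lemma is_product_joint_mono (C : category) (J : Type) (X : J -> C) (P : C)
    (p : forall j, hom P (X j)) (Z : C) (g h : hom Z P) :
  is_product p -> (forall j, p j \oc g = p j \oc h) -> g = h.
Proof.
move=> prodP gh; have [k [_ k_uniq]] := prodP Z (fun j => p j \oc h).
by rewrite -(k_uniq g gh) -(k_uniq h (fun=> erefl)).
Qed.

Section LetterProjections.
Variables (S : Type) (w : seq S).

Local Notation letter j := (tnth (in_tuple w) j).

Lemma letter_projP (j : 'I_(size w)) (k : 'I_(size [:: letter j])) :
  letter j = tnth (in_tuple [:: letter j]) k.
Proof. by rewrite [k]ord1. Qed.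

(** Unification with [letter_projP] makes the reindexing constant at [j]. *)
Definition letter_proj (j : 'I_(size w)) : @hom (words S) w [:: letter j] :=
  WordHom (letter_projP j).

(** A morphism from [Z] to [w] chooses, independently for each position of [w], a position of [Z]
    with the same letter; each choice is a morphism to a one-letter word. *)
Lemma word_is_product :
  @is_product (words S) _ (fun j => [:: letter j]) w letter_proj.
Proof.
move=> Z f.
have liftP j : tnth (in_tuple Z) ((f j : word_hom _ _) ord0) = letter j.
  by rewrite reindexP.
exists (WordHom liftP); split=> [j | h hf].
  by apply: word_hom_ext => k; rewrite [k]ord1.
by apply: word_hom_ext => j /=; rewrite -hf.
Qed.

End LetterProjections.

Lemma nattrans_eq_on_letters (S : Type) (T : algebraic_theory S) (A : category)
    (F G : functor T A) (u v : nattrans F G) :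
  preserves_finite_products G ->
  (forall s : S, u (th_functor T [:: s]) = v (th_functor T [:: s])) -> u = v.
Proof.
move=> Gprod uv; apply: nattrans_ext => a.
(* [th_functor_ob] is only a propositional equality, so the argument runs on objects
   [th_functor T w] and is transported to [a] at the end. *)
suff uvT w : u (th_functor T w) = v (th_functor T w).
  by have := uvT a; rewrite (th_functor_ob T a).
have prodT := @th_functor_products _ T _ _ _ _ (@word_is_product S w).
apply: is_product_joint_mono (Gprod _ _ _ _ prodT) _ => j.
by rewrite -!natural uv.
Qed.

Theorem proposition1 (S : Type) (T : algebraic_theory S) (A : abelian_category)
    (I : set (seq S)) (hI : range (fun s : S => [:: s]) `<=` I) :
  faithful (Box T A I).
Proof.
move=> F G u v uv; apply: nattrans_eq_on_letters (svalP G) _ => s.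
have Is : I [:: s] by apply: hI; exists s.
(* The component of [fmap (Box T A I) u] at [[:: s]] is [u (th_functor T [:: s])] by computation. *)
exact: (congr1 (fun t : nattrans (Box T A I F) (Box T A I G) =>
                  component t (exist _ [:: s] Is)) uv).
Qed.
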